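(* Let $\mathcal{G}$ be an $n$-dimensional matrix Lie group with Lie algebra $\mathfrak{g}$. Consider a trajectory $X=X(t)\in\mathcal{G}$ with $X=\exp(\phi)$, $\phi=\phi(t)\in\mathbb{R}^n$, and let $\xi^{\wedge}\in\mathfrak{g}$ (with $\xi\in\mathbb{R}^n$) be the control input. Let $K\in\mathbb{R}^{n\times n}$ be a gain matrix with only positive eigenvalues. Then the system $$\dot{X}=X\xi^{\wedge}$$ is exponentially stabilized to $X=I$ by the linear feedback $\xi=-K\phi$; that is, the equilibrium $\phi=0$ (equivalently $X=I$) of the closed-loop system $\dot X = X(-K\phi)^{\wedge}$, $X=\exp(\phi)$, is exponentially stable.
   Context: The map $(\cdot)^{\wedge}:\mathbb{R}^n\to\mathfrak{g}$ is a fixed linear isomorphism, where $n=\dim\mathfrak{g}$. The Lie exponential map is $\exp:\mathbb{R}^n\to\mathcal{G}$, $\exp(\phi)=\exp_m(\phi^{\wedge})$, where $\exp_m$ is the matrix exponential. The Lie logarithm $\log:\mathcal{G}\to\mathbb{R}^n$ is the inverse of $\exp$ (principal branch), so $\phi=\log(X)$. $I$ is the identity of $\mathcal{G}$. The equilibrium $\phi=0$ is exponentially stable if there exist $\alpha,\beta>0$ such that $\|\phi(t)\|\le\beta\|\phi(0)\|\exp(-\alpha t)$ for all $t\ge 0$, for trajectories starting in some neighborhood of the equilibrium. *)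

(* Defs.v *)
(* MathComp / MathComp-Analysis *)
From HB Require Import structures.
From mathcomp Require Export all_boot all_order all_algebra.
From mathcomp Require Export all_classical all_reals all_analysis.
From mathcomp Require Export complex.
Export Order.TTheory GRing.Theory Num.Theory.
Export numFieldNormedType.Exports.

Set Implicit Arguments.
Unset Strict Implicit.
Unset Printing Implicit Defensive.

Local Open Scope classical_set_scope.
Local Open Scope ring_scope.

Section MatrixLieGroups.
Context {R : realType} {N : nat}.

(* Closed subgroup of GL_N(R).  The topological condition is closedness
   relative to GL_N(R): a limit of elements of G lies in G or is singular. *)
Record matrix_lie_group (G : set 'M[R]_N) : Prop := MatrixLieGroup {
  mlg_unit : forall A, G A -> A \in unitmx;
  mlg_one : G 1%:M;
  mlg_mul : forall A B, G A -> G B -> G (A *m B);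
  mlg_inv : forall A, G A -> G (invmx A);
  mlg_closed : forall A, closure G A -> A \in unitmx -> G A
}.

Definition expmx (A : 'M[R]_N) : 'M[R]_N :=
  limn (series (fun k : nat => (k`!%:R)^-1 *: A ^+ k)).

Definition lie_algebra (G : set 'M[R]_N) : set 'M[R]_N :=
  [set A | forall t : R, G (expmx (t *: A))].

End MatrixLieGroups.

Section Coordinates.
Context {R : realType} {N n : nat}.

(* hat is a linear isomorphism from R^n onto the Lie algebra of G; its
   existence is what makes G an n-dimensional group. *)
Definition hat_isomorphism (G : set 'M[R]_N)
    (hat : {linear 'cV[R]_n -> 'M[R]_N}) : Prop :=
  injective hat /\ range hat = lie_algebra G.

Definition lie_exp (hat : {linear 'cV[R]_n -> 'M[R]_N}) (phi : 'cV[R]_n) :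
  'M[R]_N := expmx (hat phi).

Definition enorm (v : 'cV[R]_n) : R := Num.sqrt (\sum_i v i 0 ^+ 2).

(* 0 < z in R[i] means that z is real and positive; the eigenvalues are the
   complex ones, so that a K without real eigenvalues is excluded. *)
Definition only_positive_eigenvalues (K : 'M[R]_n) : Prop :=
  forall z : R[i], eigenvalue (map_mx (real_complex R) K) z -> 0 < z.

(* The system X' = X xi^ on the open time interval ]0, T[. *)
Definition kinematics (hat : {linear 'cV[R]_n -> 'M[R]_N}) (T : \bar R)
    (X : R -> 'M[R]_N) (xi : R -> 'cV[R]_n) : Prop :=
  forall t : R, 0 < t -> (t%:E < T)%E ->
    is_derive t 1 X (X t *m hat (xi t)).

(* A closed-loop trajectory on [0, T[, where T may be +oo.  Continuity of phi
   keeps it on one branch of the logarithm of X; for phi t small this is the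
   principal branch.  The equation at t = 0 is not imposed: it only says
   something about the right derivative there, which follows by continuity. *)
Record closed_loop (G : set 'M[R]_N) (hat : {linear 'cV[R]_n -> 'M[R]_N})
    (K : 'M[R]_n) (T : \bar R) (X : R -> 'M[R]_N) (phi : R -> 'cV[R]_n) :
    Prop := ClosedLoop {
  cl_group : forall t : R, 0 <= t -> (t%:E < T)%E -> G (X t);
  cl_exp : forall t : R, 0 <= t -> (t%:E < T)%E -> X t = lie_exp hat (phi t);
  cl_cont : {within [set t : R | 0 <= t /\ (t%:E < T)%E], continuous phi};
  cl_ode : kinematics hat T X (fun t => - (K *m phi t))
}.

(* traj T phi means that phi is a trajectory on [0, T[.  The estimate is
   required on the whole interval of existence of each trajectory; for
   T = +oo this is the estimate for all t >= 0. *)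
Definition exponentially_stable_at0
    (traj : \bar R -> (R -> 'cV[R]_n) -> Prop) : Prop :=
  traj +oo%E (cst 0) /\
  exists alpha beta : R, exists U : set 'cV[R]_n,
    [/\ 0 < alpha, 0 < beta, nbhs (0 : 'cV[R]_n) U &
      forall (T : \bar R) (phi : R -> 'cV[R]_n), traj T phi -> U (phi 0) ->
        forall t : R, 0 <= t -> (t%:E < T)%E ->
          enorm (phi t) <= beta * enorm (phi 0) * expR (- alpha * t)].

End Coordinates.

(* Main.v *)
From HB Require Import structures.
Require Import Defs.
From mathcomp Require Import ring lra.

Set Implicit Arguments.
Unset Strict Implicit.
Unset Printing Implicit Defensive.

Local Open Scope classical_set_scope.
Local Open Scope ring_scope.

(** In logarithmic coordinates the closed loop X' = - X (K phi)^ reads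
    phi' = - K phi + O(|phi|^2), because exp is the identity to first order
    at 0; and the linear equation phi' = - K phi is exponentially stable because
    the eigenvalues of K are positive. Stability of the linear part is expressed
    by a Lyapunov form, and the form tolerates the quadratic error near 0.

    Differentiability of phi and convergence of the matrix logarithm are both
    avoided. The estimate norm_expmxB_le says that exp B - exp A differs from
    B - A by a small multiple of B - A when A and B are small. Applied to
    A = hat (phi t) and B = hat (phi (t + h)), it turns the derivative of X into
    a first-order expansion to the right of phi itself (linearized_flow), with
    an error as small as desired relative to |phi t|. Only the injectivity and
    linearity of hat enter.

    On the linear side, lyapunov_form produces an invertible B and c > 0 with
    c |B v|^2 <= <B v, B K v>, by triangularizing K one left eigenvector at a
    time. Together with the expansion of phi this gives
    W (t + h) <= (1 - h c) W t for W t = |B phi(t)|^2 small and h > 0 small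
    (lyapunov_step). Finally exponential_comparison integrates these one-sided
    increments into W t <= W 0 exp (- c t), on the whole interval of existence,
    and equivalence of norms gives the estimate for phi with rate c / 2. *)

(** * The maximum norm of matrices *)

Section MaxNorm.
Context {R : realType}.

Lemma norm_entry_le m n (A : 'M[R]_(m, n)) i j : `|A i j| <= `|A|.
Proof. by rewrite [leRHS]/Num.norm /= mx_normrE; exact: (le_bigmax _ _ (i, j)). Qed.

Lemma norm_mx_le m n (A : 'M[R]_(m, n)) (e : R) :
  0 <= e -> (forall i j, `|A i j| <= e) -> `|A| <= e.
Proof.
by move=> e0 h; rewrite [leLHS]/Num.norm /= mx_normrE; apply/bigmax_leP; split.
Qed.

(** The maximum norm is submultiplicative only up to the inner dimension; this
    is where the factor N%:R in the estimates of the exponential comes from. *)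
Lemma norm_mulmx_le m n p (A : 'M[R]_(m, n)) (B : 'M[R]_(n, p)) :
  `|A *m B| <= n%:R * `|A| * `|B|.
Proof.
apply: norm_mx_le => [|i j]; first by rewrite !mulr_ge0.
rewrite mxE (le_trans (ler_norm_sum _ _ _))//.
apply: (@le_trans _ _ (\sum_(k < n) `|A| * `|B|)).
  by apply: ler_sum => k _; rewrite normrM ler_pM ?norm_entry_le.
by rewrite sumr_const card_ord -mulrA mulr_natl.
Qed.

End MaxNorm.

(** * The exponential near zero *)

Section SmallExponential.
Context {R : realType} {N : nat}.
Implicit Types (A B : 'M[R]_N) (r : R).

Let expt A k : 'M[R]_N := (k`!%:R)^-1 *: A ^+ k.

Lemma norm_expr_mx_le A k : `|A ^+ k.+1| <= (N%:R * `|A|) ^+ k * `|A|.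
Proof.
elim: k => [|k IH]; first by rewrite expr1 expr0 mul1r.
rewrite exprS (le_trans (norm_mulmx_le _ _))// [in leRHS]exprS -[leRHS]mulrA.
by rewrite ler_wpM2l ?mulr_ge0.
Qed.

(** Telescoping B^(k+2) - A^(k+2) = B (B^(k+1) - A^(k+1)) + (B - A) A^(k+1): the
    k + 1 copies of B - A carry k further factors of norm at most r, so this is
    the mean value inequality for the power map, without commutativity. *)
Lemma norm_expr_mxB_le A B r k : `|A| <= r -> `|B| <= r ->
  `|B ^+ k.+1 - A ^+ k.+1| <= k.+1%:R * (N%:R * r) ^+ k * `|B - A|.
Proof.
move=> Ar Br; have r0 : 0 <= r by rewrite (le_trans _ Ar).
elim: k => [|k IH]; first by rewrite !expr1 expr0 !mul1r.
have -> : B ^+ k.+2 - A ^+ k.+2 = B * (B ^+ k.+1 - A ^+ k.+1) + (B - A) * A ^+ k.+1.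
  by rewrite mulrBr mulrBl !exprS addrA subrK.
have h1 : `|B * (B ^+ k.+1 - A ^+ k.+1)| <=
    N%:R * r * (k.+1%:R * (N%:R * r) ^+ k * `|B - A|).
  rewrite (le_trans (norm_mulmx_le _ _))// ler_pM ?mulr_ge0//.
  by rewrite ler_wpM2l.
have h2 : `|(B - A) * A ^+ k.+1| <= N%:R * `|B - A| * ((N%:R * r) ^+ k * r).
  rewrite (le_trans (norm_mulmx_le _ _))// ler_wpM2l ?mulr_ge0//.
  rewrite (le_trans (norm_expr_mx_le _ _))// ler_pM ?exprn_ge0 ?mulr_ge0//.
  by rewrite lerXn2r ?nnegrE ?mulr_ge0// ler_wpM2l.
apply: le_trans (ler_normD _ _) _; apply: le_trans (lerD h1 h2) _.
rewrite le_eqVlt; apply/orP; left; apply/eqP.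
by rewrite -[k.+2%:R]natr1 exprS; ring.
Qed.

(** Convergence is only needed near 0, where the series is dominated by a
    geometric one of ratio 1/2. *)
Lemma is_cvg_expmx A : N%:R * `|A| <= 2^-1 -> cvgn (series (expt A)).
Proof.
move=> hA.
have cn : cvgn [normed series (expt A)].
  apply: (@series_le_cvg _ _ (geometric (1 + 2 * `|A|) 2^-1)) => //.
  - by move=> k; exact: normr_ge0.
  - by move=> k /=; rewrite mulr_ge0 ?exprn_ge0 ?addr_ge0 ?mulr_ge0 ?invr_ge0.
  - case=> [|k] /=.
      rewrite /expt fact0 invr1 scale1r !expr0 mulr1.
      apply: (@le_trans _ _ 1); last by rewrite lerDl mulr_ge0.
      apply: norm_mx_le => // i j; rewrite mxE.
      by case: (i == j); rewrite ?mulr1n ?mulr0n ?normr1 ?normr0.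
    rewrite normrZ ger0_norm ?invr_ge0//.
    apply: (@le_trans _ _ (`|A ^+ k.+1|)).
      by rewrite ler_piMl// invf_le1 ?ler1n ?ltr0n ?fact_gt0.
    apply: le_trans (norm_expr_mx_le _ _) _.
    apply: (@le_trans _ _ (2^-1 ^+ k * `|A|)).
      by rewrite ler_wpM2r// lerXn2r ?nnegrE ?mulr_ge0 ?invr_ge0.
    have -> : (1 + 2 * `|A|) * 2^-1 ^+ k.+1 = 2^-1 ^+ k * (2^-1 + `|A|).
      by rewrite exprS; field.
    by rewrite ler_wpM2l ?exprn_ge0 ?invr_ge0// lerDr invr_ge0.
  - by apply: is_cvg_geometric_series; rewrite ger0_norm ?invr_ge0//; lra.
move: cn => /cauchy_cvgP/cauchy_seriesP u_ncvg.
apply/cauchy_cvgP/cauchy_seriesP => e /u_ncvg.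
apply: filterS => n /=; rewrite ger0_norm ?sumr_ge0//.
by apply: le_lt_trans; apply: ler_norm_sum.
Qed.

Lemma sum_expr_le r m : 0 <= r -> r <= 2^-1 ->
  \sum_(k < m) r ^+ k.+1 <= 2 * r.
Proof.
move=> r0 r2.
apply: (@le_trans _ _ (2 * r * (1 - r ^+ m))); last first.
  by rewrite ler_piMr ?mulr_ge0// gerBl exprn_ge0.
elim: m => [|m IH]; first by rewrite big_ord0 expr0 subrr mulr0.
rewrite big_ord_recr /=; apply: le_trans (lerD IH (lexx _)) _.
have : 0 <= r ^+ m * r * (1 - 2 * r).
  by rewrite !mulr_ge0 ?exprn_ge0//; lra.
by rewrite exprS; lra.
Qed.

Lemma expmx0 : expmx (0 : 'M[R]_N) = 1%:M.
Proof.
apply/cvg_lim => //; apply: cvg_near_cst; exists 1%N => // -[//|m _] /=.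
rewrite /series /= big_nat_recl// big1_seq ?addr0 => [|k _].
  by rewrite fact0 invr1 scale1r expr0.
by rewrite expr0n scaler0.
Qed.

(** The exponential is a small perturbation of the identity map near 0, in the
    strong (Lipschitz) sense: the terms of degree at least 2 of the series have
    Lipschitz constant O(r) on the ball of radius r. With A = 0 it bounds
    exp B - 1 - B; in general it allows a bound on B - A to be recovered from
    one on exp B - exp A, which replaces the logarithm. *)
Lemma norm_expmxB_le A B r : N%:R * r <= 2^-1 -> `|A| <= r -> `|B| <= r ->
  `|expmx B - expmx A - (B - A)| <= 2 * (N%:R * r) * `|B - A|.
Proof.
move=> hr Ar Br; have r0 : 0 <= r by rewrite (le_trans _ Ar).
have small (C : 'M[R]_N) : `|C| <= r -> N%:R * `|C| <= 2^-1.
  by move=> Cr; rewrite (le_trans _ hr)// ler_wpM2l.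
have cA := is_cvg_expmx (small _ Ar); have cB := is_cvg_expmx (small _ Br).
have cv : (fun m => series (expt B) m - series (expt A) m - (B - A)) @ \oo -->
    expmx B - expmx A - (B - A).
  by apply: cvgB; [apply: cvgB|exact: cvg_cst].
have cvn : (fun m => `|series (expt B) m - series (expt A) m - (B - A)|) @ \oo
    --> `|expmx B - expmx A - (B - A)| by exact: cvg_norm.
rewrite -(cvg_lim _ cvn)//; apply: limr_le; first by apply/cvg_ex; eexists; exact: cvn.
exists 2%N => // -[//|[//|m]] _ /=.
rewrite /series /= -sumrB !big_nat_recl// /expt !fact0 (_ : 1`! = 1%N)//.
rewrite !invr1 !scale1r !expr0 !expr1 subrr add0r addrAC subrr add0r.
rewrite big_mkord (le_trans (ler_norm_sum _ _ _))//.
apply: (@le_trans _ _ (\sum_(k < m) (N%:R * r) ^+ k.+1 * `|B - A|)).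
  apply: ler_sum => k _; rewrite -scalerBr normrZ ger0_norm ?invr_ge0//.
  rewrite ler_pdivrMl ?ltr0n ?fact_gt0//.
  rewrite (le_trans (norm_expr_mxB_le _ Ar Br))// -mulrA.
  rewrite ler_wpM2r ?mulr_ge0 ?exprn_ge0 ?mulr_ge0// ler_nat.
  by rewrite factS leq_pmulr// fact_gt0.
by rewrite -mulr_suml ler_wpM2r// sum_expr_le// mulr_ge0.
Qed.

End SmallExponential.

(** * Eigenvalues, triangularization and the Lyapunov form *)

Lemma eigenvalue_conj (F : fieldType) n (S K M : 'M[F]_n) z :
  S \in unitmx -> S *m K = M *m S -> eigenvalue M z -> eigenvalue K z.
Proof.
move=> Su SK /eigenvalueP[u uM u0]; apply/eigenvalueP; exists (u *m S).
  by rewrite -mulmxA SK mulmxA uM -scalemxAl.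
by apply: contraNneq u0 => uS0; rewrite -(mulmxK Su u) uS0 mul0mx.
Qed.

(** A left eigenvector u of K for z extends to the left eigenvector
    (a, u) of the block matrix with a = (u b) / (z - l), unless z = l. *)
Lemma eigenvalue_block (F : fieldType) n (l z : F) (b : 'M[F]_(n, 1)) (K : 'M[F]_n) :
  eigenvalue K z -> z = l \/ eigenvalue (block_mx l%:M 0 b K) z.
Proof.
move=> /eigenvalueP[u uK u0]; have [->|zl] := eqVneq z l; [by left|right].
have dz : z - l != 0 by rewrite subr_eq0.
apply/eigenvalueP; exists (row_mx ((z - l)^-1 *: (u *m b)) u); last first.
  by apply: contraNneq u0 => /eqP; rewrite row_mx_eq0 => /andP[_].
rewrite mul_row_block scale_row_mx mulmx0 add0r uK; congr row_mx.
rewrite mul_mx_scalar scalerA -[X in _ + X]scale1r -scalerDl scalerA.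
by congr (_ *: _); field.
Qed.

(** One step of triangularization: take for S an invertible matrix whose first
    row spans the line of a left eigenvector w. Gaussian elimination on w
    provides it as row_ebase w. *)
Lemma triangular_conj (F : fieldType) n (K : 'M[F]_(1 + n)) l : eigenvalue K l ->
  exists S : 'M[F]_(1 + n), exists b K',
    S \in unitmx /\ S *m K = block_mx l%:M 0 b K' *m S.
Proof.
move=> /eigenvalueP[w wK w0].
pose S := row_ebase w; have Su : S \in unitmx := row_ebase_unit w.
pose M := S *m K *m invmx S.
have SK : S *m K = M *m S by rewrite mulmxKV.
have wE : pid_mx 1 *m S = invmx (col_ebase w) *m w.
  by rewrite -{2}(mulmx_ebase w) (rank_rV w) w0 !mulmxA mulVmx ?col_ebase_unit// mul1mx.
have eM : pid_mx 1 *m M = l *: (pid_mx 1 : 'M[F]_(1, 1 + n)).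
  by rewrite /M !mulmxA wE -(mulmxA _ w) wK -scalemxAr -wE -scalemxAl mulmxK.
have uM : usubmx M = row_mx l%:M 0.
  have pid : (pid_mx 1 : 'M[F]_(1, 1 + n)) = row_mx 1%:M 0 by rewrite pid_mx_row.
  move: eM; rewrite pid -{1}(vsubmxK M) mul_row_col mul1mx mul0mx addr0 => ->.
  by rewrite scale_row_mx scaler0 scalemx1.
exists S, (dlsubmx M), (drsubmx M); split => //; rewrite SK; congr (_ *m _).
rewrite -{1}(submxK M); congr block_mx.
  by rewrite /ulsubmx uM row_mxKl.
by rewrite /ursubmx uM row_mxKr.
Qed.

Lemma positive_eigenvalue (R : realType) n (K : 'M[R]_n.+1) :
  only_positive_eigenvalues K -> exists2 l : R, 0 < l & eigenvalue K l.
Proof.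
move=> hK; pose Kc := map_mx (real_complex R) K.
have /closed_rootP[z] : size (char_poly Kc) != 1 by rewrite size_char_poly.
rewrite -eigenvalue_root_char => ez; have z0 := hK _ ez.
have zE : z = real_complex R (complex.Re z).
  by move: z0; case: (z) => a b; rewrite ltcE /= => /andP[/eqP -> _].
exists (complex.Re z); first by move: z0; rewrite ltcE => /andP[].
by move: ez; rewrite zE eigenvalue_map.
Qed.

Section Quadratic.
Context {R : realType}.

Definition dotv n (u v : 'cV[R]_n) : R := \sum_i u i 0 * v i 0.

Lemma dotvDr n (u v w : 'cV[R]_n) : dotv u (v + w) = dotv u v + dotv u w.
Proof. by rewrite -big_split; apply: eq_bigr => i _; rewrite mxE mulrDr. Qed.

Lemma dotvZr n a (u v : 'cV[R]_n) : dotv u (a *: v) = a * dotv u v.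
Proof. by rewrite mulr_sumr; apply: eq_bigr => i _; rewrite mxE mulrCA. Qed.

Lemma dotvC n (u v : 'cV[R]_n) : dotv u v = dotv v u.
Proof. by apply: eq_bigr => i _; rewrite mulrC. Qed.

Lemma dotvv_ge0 n (u : 'cV[R]_n) : 0 <= dotv u u.
Proof. by apply: sumr_ge0 => i _; rewrite -expr2 sqr_ge0. Qed.

Lemma dotv_col m n (u v : 'cV[R]_m) (u' v' : 'cV[R]_n) :
  dotv (col_mx u u') (col_mx v v') = dotv u v + dotv u' v'.
Proof.
rewrite /dotv big_split_ord /=; congr (_ + _); apply: eq_bigr => i _.
  by rewrite !col_mxEu.
by rewrite !col_mxEd.
Qed.

(** Weighted arithmetic-geometric mean inequality. It is used where
    Cauchy-Schwarz would be usual, the weight e being chosen to absorb cross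
    terms. *)
Lemma dotv_young n e (u v : 'cV[R]_n) : 0 < e ->
  2 * dotv u v <= e * dotv u u + e^-1 * dotv v v.
Proof.
move=> e0; rewrite !mulr_sumr -big_split; apply: ler_sum => i _ /=.
have : 0 <= e^-1 * (e * u i 0 - v i 0) ^+ 2 by rewrite mulr_ge0 ?sqr_ge0 ?invr_ge0 ?ltW.
have -> : e^-1 * (e * u i 0 - v i 0) ^+ 2 =
  e * (u i 0 * u i 0) + e^-1 * (v i 0 * v i 0) - 2 * (u i 0 * v i 0).
  by field; rewrite gt_eqF.
by rewrite subr_ge0.
Qed.

(** Lyapunov's theorem for the linear equation v' = - K v: the quadratic form
    |B v|^2 decreases at a rate proportional to itself. By induction on the
    dimension: in the coordinates (x, z) in which K is the block triangular
    matrix with blocks l, 0, b, K', the form m^2 x^2 + |B' z|^2 works as soon as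
    m is large enough for the two diagonal contributions, l m^2 x^2 and
    c' |B' z|^2, to dominate the cross term x <B' z, B' b>. *)
Lemma lyapunov_form n (K : 'M[R]_n) : only_positive_eigenvalues K ->
  exists B : 'M[R]_n, exists2 c : R, 0 < c & B \in unitmx /\
    forall v, c * dotv (B *m v) (B *m v) <= dotv (B *m v) (B *m (K *m v)).
Proof.
elim: n K => [|n IH] K hK.
  exists 1%:M, 1 => //; split; first exact: unitmx1.
  by move=> v; rewrite /dotv !big_ord0 mulr0.
have [l l0 eK] := positive_eigenvalue hK.
have [S [b [K' [Su SK]]]] := triangular_conj eK.
have hK' : only_positive_eigenvalues K'.
  move=> z ez.
  have [->|] := eigenvalue_block (real_complex R l) (map_mx (real_complex R) b) ez.
    by rewrite ltcR.
  rewrite -(map_scalar_mx (real_complex R)) -(map_mx0 (real_complex R)) -map_block_mx.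
  move=> /eigenvalue_conj ec; apply: hK; apply: ec.
  - by rewrite -(map_unitmx (real_complex R)) in Su; exact: Su.
  - by rewrite -!map_mxM SK.
have [B' [c' c'0 [B'u hB']]] := IH K' hK'.
(* m is chosen so that m^2 l c' >= |B' b|^2, the discriminant condition for
   halves of the diagonal terms to dominate the cross term. *)
pose d := dotv (B' *m b) (B' *m b); have d0 : 0 <= d := dotvv_ge0 _.
pose m := d / (l * c') + 1; have m0 : 0 < m by rewrite ltr_wpDl// divr_ge0// mulr_ge0 ?ltW.
have dm : d <= l * c' * m ^+ 2.
  have lc : 0 < l * c' by rewrite mulr_gt0.
  have -> : d = l * c' * (m - 1) by rewrite /m; field; rewrite !gt_eqF.
  rewrite ler_pM2l//; have m1 : 1 <= m by rewrite lerDr divr_ge0// ltW.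
  by nra.
pose D : 'M[R]_(1 + n) := block_mx m%:M 0 0 B'.
pose c := Num.min l c' / 2; have c0 : 0 < c by rewrite divr_gt0// lt_min l0.
have cl : 2 * c <= l by rewrite /c mulrC divfK// ge_min lexx.
have cc' : 2 * c <= c' by rewrite /c mulrC divfK// ge_min lexx orbT.
exists (D *m S), c => //; split.
  rewrite unitmx_mul Su andbT unitmxE.
  have -> : \det D = m * \det B' by rewrite /D det_ublock det_scalar expr1.
  by rewrite unitrM -unitmxE B'u unitfE gt_eqF.
move=> v; rewrite -!mulmxA (mulmxA S) SK -mulmxA.
move: (S *m v) => y; rewrite -(vsubmxK y).
move: (usubmx y) (dsubmx y) => x z {y}.
rewrite mul_block_col mul0mx addr0 mul_scalar_mx.
have DE u w : D *m col_mx u w = col_mx (m *: u) (B' *m w).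
  by rewrite /D mul_block_col !mul0mx addr0 add0r mul_scalar_mx.
have dotE (u u' : 'cV[R]_1) (w w' : 'cV[R]_n) :
    @dotv n.+1 (col_mx u w) (col_mx u' w') = dotv u u' + dotv w w'.
  exact (@dotv_col 1 n u u' w w').
rewrite !DE !dotE.
rewrite mulmxDr dotvDr.
have -> : b *m x = x 0 0 *: b.
  by rewrite [x]mx11_scalar mul_mx_scalar mxE eqxx mulr1n.
rewrite -scalemxAr (dotvZr _ (B' *m z) (B' *m b)); have := hB' z.
have := dotvv_ge0 (B' *m z).
set Z := B' *m z; set KZ := B' *m (K' *m z) => Z0 hZ.
set X := x 0 0.
have xx : dotv (m *: x) (m *: x) = m ^+ 2 * X ^+ 2.
  by rewrite /dotv big_ord1 !mxE; rewrite /X; ring.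
have xlx : dotv (m *: x) (m *: (l *: x)) = l * (m ^+ 2 * X ^+ 2).
  by rewrite /dotv big_ord1 !mxE; rewrite /X; ring.
rewrite xx xlx.
have := @dotv_young _ c' Z (- X *: (B' *m b)) c'0.
rewrite !dotvZr (dotvC (- X *: _)) dotvZr -/d => hy.
have hd : c'^-1 * (- X * (- X * d)) <= l * (m ^+ 2 * X ^+ 2).
  rewrite ler_pdivrMl//; have := ler_wpM2r (sqr_ge0 X) dm; nra.
have p1 : 0 <= (l - 2 * c) * (m ^+ 2 * X ^+ 2).
  by rewrite mulr_ge0 ?subr_ge0// mulr_ge0 ?sqr_ge0.
have p2 : 0 <= (c' - 2 * c) * dotv Z Z by rewrite mulr_ge0 ?subr_ge0.
by lra.
Qed.

End Quadratic.

(** * Bounds for linear maps into matrices *)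

Section LinearBounds.
Context {R : realType} {N n : nat}.
Implicit Types f : {linear 'cV[R]_n -> 'M[R]_N}.

Lemma linear_mx_bounded f : exists2 C : R, 0 < C & forall v, `|f v| <= C * `|v|.
Proof.
exists (1 + \sum_i `|f (delta_mx i 0)|); first by rewrite ltr_wpDr ?sumr_ge0.
move=> v; apply: (@le_trans _ _ ((\sum_i `|f (delta_mx i 0)|) * `|v|)).
  rewrite {1}[v]matrix_sum_delta linear_sum mulr_suml.
  rewrite (le_trans (ler_norm_sum _ _ _))//; apply: ler_sum => i _.
  by rewrite big_ord1 linearZ normrZ mulrC ler_wpM2l// norm_entry_le.
by rewrite ler_wpM2r// lerDr.
Qed.

(** An injective linear map has a linear left inverse, which is bounded; the
    inverse is obtained from the matrix of f on row vectors. *)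
Lemma linear_mx_bounded_below f : injective f ->
  exists2 C : R, 0 < C & forall v, `|v| <= C * `|f v|.
Proof.
move=> f_inj.
pose g (u : 'rV[R]_n) := mxvec (f u^T).
have g_lin : linear g by move=> a u w; rewrite /g !linearP.
pose gL : {linear 'rV[R]_n -> 'rV[R]_(N * N)} :=
  HB.pack g (GRing.isLinear.Build _ _ _ _ g g_lin).
have /row_freeP[P gP] : row_free (lin1_mx gL).
  apply: inj_row_free => u; rewrite mul_rV_lin1 /= /g => /eqP.
  rewrite mxvec_eq0 => /eqP fu0; apply: trmx_inj; apply: f_inj.
  by rewrite fu0 trmx0 linear0.
exists (1 + (N * N)%:R * `|P|); first by rewrite ltr_wpDr ?mulr_ge0.
move=> v.
have vE : v = (mxvec (f v) *m P)^T.
  have -> : mxvec (f v) = v^T *m lin1_mx gL by rewrite mul_rV_lin1 /= /g trmxK.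
  by rewrite -mulmxA gP mulmx1 trmxK.
have trN m (A : 'M[R]_(m, n)) : `|A^T| <= `|A|.
  by apply: norm_mx_le => // i j; rewrite mxE norm_entry_le.
have vecN : `|mxvec (f v)| <= `|f v|.
  apply: norm_mx_le => // i j; case/mxvec_indexP: j => j k.
  by rewrite ord1 mxvecE norm_entry_le.
rewrite {1}vE (le_trans (trN _ _))// (le_trans (norm_mulmx_le _ _))//.
apply: (@le_trans _ _ ((N * N)%:R * `|f v| * `|P|)).
  by rewrite ler_wpM2r// ler_wpM2l.
by rewrite mulrAC ler_wpM2r// lerDr.
Qed.

End LinearBounds.

(** * Comparison with a decreasing exponential *)

(** A Gronwall-type comparison which needs no derivative of W, only a bound on
    its increments to the right of each point, and only where W < r. If W
    overtook g t = (W 0 + d) exp (- c t) before t1, then at the last time t0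
    before t1 with W <= g one has W t0 = g t0 < r, and the bound on the
    increments keeps W below g just after t0, a contradiction. Working at that
    single time makes a separate argument that W stays below r unnecessary. *)
Lemma exponential_comparison (R : realType) (T : \bar R) (c r : R) (W : R -> R) :
  0 < c -> 0 <= W 0 -> W 0 < r ->
  {within [set t : R | 0 <= t /\ (t%:E < T)%E], continuous W} ->
  (forall t, 0 < t -> (t%:E < T)%E -> 0 < W t -> W t < r ->
    \forall h \near 0^'+, W (t + h) <= (1 - h * c) * W t) ->
  forall t, 0 <= t -> (t%:E < T)%E -> W t <= W 0 * expR (- c * t).
Proof.
move=> c0 W0 W0r Wc Wstep t1 t10 t1T.
suff H d : 0 < d -> W 0 + d < r -> W t1 <= (W 0 + d) * expR (- c * t1).
  apply/ler_addgt0Pr => e e0.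
  pose d := Num.min e ((r - W 0) / 2).
  have d0 : 0 < d by rewrite lt_min e0 divr_gt0// subr_gt0.
  have de : d <= e by rewrite ge_min lexx.
  have dr : d <= (r - W 0) / 2 by rewrite ge_min lexx orbT.
  have {}H : W t1 <= (W 0 + d) * expR (- c * t1) by apply: H => //; lra.
  apply: le_trans H _.
  rewrite mulrDl lerD2l (le_trans _ de)// ler_piMr ?(ltW d0)//.
  by rewrite -expR0 ler_expR mulNr oppr_le0 mulr_ge0// ltW.
move=> d0 dr; rewrite leNgt; apply/negP => Wt1.
pose g t := (W 0 + d) * expR (- c * t).
have Wd0 : 0 < W 0 + d by rewrite ltr_wpDl.
have g0 t : 0 < g t by rewrite mulr_gt0 ?expR_gt0.
have gr t : 0 <= t -> g t < r.
  move=> t0; apply: le_lt_trans dr; rewrite ler_piMr ?(ltW Wd0)//.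
  by rewrite -expR0 ler_expR mulNr oppr_le0 mulr_ge0// ltW.
have gcont : continuous g.
  move=> x; apply: cvgM; first exact: cvg_cst.
  apply: continuous_comp; last exact: continuous_expR.
  by apply: cvgM; [exact: cvg_cst|exact: cvg_id].
pose f t := W t - g t.
have fc x e : 0 <= x -> x <= t1 -> 0 < e ->
    exists2 q, 0 < q & forall s, 0 <= s -> s <= t1 -> `|x - s| < q -> `|f x - f s| < e.
  move=> x0 xt e0.
  have xD : 0 <= x /\ (x%:E < T)%E by split=> //; rewrite (le_lt_trans _ t1T)// lee_fin.
  have /subspace_continuousP/(_ x xD) Wx := Wc.
  have fx : f @ within [set t : R | 0 <= t /\ (t%:E < T)%E] (nbhs x) --> f x.
    by apply: cvgB; [exact: Wx|apply: cvg_within_filter; exact: gcont].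
  move/cvgrPdist_lt : fx => /(_ e e0); rewrite near_withinE => -[q /= q0 Hq].
  exists q => // s s0 st xs; apply: Hq => //.
  by split=> //; rewrite (le_lt_trans _ t1T)// lee_fin.
pose S := [set t | [/\ 0 <= t, t <= t1 & f t <= 0]].
have S0 : S 0.
  by split=> //; rewrite /f /g mulr0 expR0 mulr1; lra.
have Sub : has_ubound S by exists t1 => s [].
pose t0 := sup S.
have t00 : 0 <= t0 by exact: (ub_le_sup Sub S0).
have t01 : t0 <= t1 by apply: ge_sup; [exists 0|move=> s []].
have supS s : 0 <= s -> s <= t1 -> f s <= 0 -> s <= t0.
  by move=> *; apply: (ub_le_sup Sub).
(* By continuity f t0 = 0: neither sign is compatible with t0 being the supremum
   of the times at which f <= 0. *)
have fle : f t0 <= 0.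
  rewrite leNgt; apply/negP => fp; have [q q0 hq] := fc t0 _ t00 t01 fp.
  have [s [s0 s1 fs] sq] : exists2 s, S s & t0 - q < s.
    by apply: sup_adherent => //; split; [exists 0|].
  have st : s <= t0 by apply: supS.
  have := hq s s0 s1; rewrite ger0_norm ?subr_ge0// ltrBlDl -ltrBlDr => /(_ sq).
  by move=> /ltr_normlW; lra.
have ft1 : 0 < f t1 by rewrite subr_gt0.
have t0lt : t0 < t1.
  by rewrite lt_neqAle t01 andbT; apply: contraTneq ft1 => <-; rewrite -leNgt.
have fge : 0 <= f t0.
  rewrite leNgt; apply/negP => fn.
  have fn' : 0 < - f t0 by rewrite oppr_gt0.
  have [q q0 hq] := fc t0 _ t00 t01 fn'.
  pose m := Num.min (q / 2) (t1 - t0).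
  have m0 : 0 < m by rewrite lt_min divr_gt0// subr_gt0.
  have mq : m <= q / 2 by rewrite ge_min lexx.
  have mt : m <= t1 - t0 by rewrite ge_min lexx orbT.
  have sm : 0 <= t0 + m by rewrite addr_ge0// ltW.
  have sm1 : t0 + m <= t1 by lra.
  have := hq _ sm sm1; have -> : t0 - (t0 + m) = - m by lra.
  rewrite normrN gtr0_norm// => /(_ ltac:(lra)) /ltr_normlP[hf _].
  have := supS (t0 + m) sm sm1; lra.
have f0 : W t0 = g t0 by apply/eqP; rewrite -subr_eq0 eq_le fle fge.
have t0p : 0 < t0.
  rewrite lt_neqAle t00 andbT; apply/eqP => t0E.
  by move: f0; rewrite -t0E /g mulr0 expR0 mulr1; lra.
have t0T : (t0%:E < T)%E by rewrite (lt_trans _ t1T)// lte_fin.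
have := Wstep t0 t0p t0T; rewrite f0 => /(_ (g0 _) (gr _ t00)) step.
near (0 : R)^'+ => h.
have h0 : 0 < h by near: h; exact: nbhs_right_gt.
have ht : h < t1 - t0 by near: h; apply: nbhs_right_lt; rewrite subr_gt0.
have hW : W (t0 + h) <= (1 - h * c) * g t0 by near: h.
have gE : g (t0 + h) = expR (- c * h) * g t0.
  by rewrite /g mulrDr expRD; ring.
have : t0 + h <= t0.
  apply: supS; [by rewrite addr_ge0// ltW|by lra|].
  rewrite subr_le0 (le_trans hW)// gE ler_wpM2r ?(ltW (g0 _))//.
  by have := expR_ge1Dx (- c * h); lra.
lra.
Unshelve. all: by end_near. Qed.

(** * First-order expansion of a trajectory *)

Section LinearizedFlow.
Context {R : realType} {N n : nat}.

Lemma near_right_shift (P : R -> Prop) t :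
  (\forall s \near t, P s) -> \forall h \near 0^'+, P (t + h).
Proof.
case=> q /= q0 Hq; exists q => // h; rewrite /ball_ /= sub0r normrN => hq _.
by apply: Hq; rewrite /= opprD addrA subrr sub0r normrN.
Qed.

(** Along a trajectory, phi' = - K phi up to an error that is small compared
    with phi. This is stated with increments because phi is only known to be
    continuous: differentiability is available for X = exp (hat phi) alone.
    Put A = hat v, A' = hat (phi (t + h)), y = hat (K v), D = A' - A and
    E = X (t + h) - X t. Then
      hat (phi (t + h) - v + h K v) = (D - E) + (E + h X y) - h (X - 1) y,
    where D - E is O(|A| |D|) by the estimate on the exponential, E + h X y is
    o(h) by the differential equation, and X - 1 is O(|A|). Since |D| is itself
    O(|E|) = O(h |y|), the sum is O(h |A| |y|), quadratic in v. Commutators, and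
    hence the right Jacobian of exp, never appear. *)
Lemma linearized_flow (hat : {linear 'cV[R]_n -> 'M[R]_N}) (K : 'M[R]_n) eta :
  injective hat -> 0 < eta -> exists2 r : R, 0 < r &
  forall (X : R -> 'M[R]_N) (phi : R -> 'cV[R]_n) t,
    (\forall s \near t, X s = lie_exp hat (phi s)) ->
    phi @ t --> phi t ->
    is_derive t 1 X (X t *m hat (- (K *m phi t))) ->
    0 < `|phi t| -> `|phi t| < r ->
    \forall h \near 0^'+,
      `|phi (t + h) - phi t + h *: (K *m phi t)| <= h * (eta * `|phi t|).
Proof.
move=> hat_inj eta0.
have [C C0 hC] := linear_mx_bounded hat.
have [C' C'0 hC'] := linear_mx_bounded_below hat_inj.
pose k := 1 + n%:R * `|K|; have k0 : 0 < k by rewrite ltr_wpDr ?mulr_ge0.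
have hk v : `|K *m v| <= k * `|v|.
  by rewrite (le_trans (norm_mulmx_le _ _))// ler_wpM2r// lerDr.
pose M : R := N%:R; have M0 : 0 <= M by rewrite /M.
(* Below r1 the exponential estimate applies on the ball of radius 2 |A| with
   Lipschitz constant at most 1/2; below r2 the quadratic error is at most half
   of eta |v|, and delta accounts for the other half. *)
pose r1 := (8 * (M + 1) * C)^-1.
pose r2 := eta / (36 * (M + 1) * C' * C ^+ 2 * k).
have M1 : 0 < M + 1 by rewrite ltr_wpDl.
have r10 : 0 < r1 by rewrite invr_gt0 !mulr_gt0.
have r20 : 0 < r2 by rewrite divr_gt0 ?mulr_gt0 ?exprn_gt0.
exists (Num.min r1 r2) => [|X phi t Xexp phic dX v0]; first by rewrite lt_min r10.
rewrite lt_min => /andP[vr1 vr2].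
set v := phi t in dX v0 vr1 vr2 *.
set A := hat v; pose a := `|A|; pose y := hat (K *m v).
have aC : a <= C * `|v| := hC v.
have a0 : 0 < a.
  by have := lt_le_trans v0 (hC' v); rewrite pmulr_rgt0.
have Ma : 8 * M * a <= 1.
  apply: (@le_trans _ _ (8 * (M + 1) * C * `|v|)).
    by rewrite -[leRHS]mulrA ler_pM ?mulr_ge0 ?(ltW a0)// ler_wpM2l// lerDl.
  by move: vr1; rewrite /r1 -[X in _ < X]mul1r ltr_pdivlMr ?mulr_gt0// mulrC => /ltW.
have yC : `|y| <= C * k * `|v|.
  by rewrite (le_trans (hC _))// -mulrA ler_wpM2l ?hk// ltW.
have y0 : 0 <= `|y| by [].
pose delta := eta * `|v| / (4 * C').
have delta0 : 0 < delta by rewrite divr_gt0 ?mulr_gt0.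
have nearX : \forall h \near 0^'+, `|X (t + h) - X t + h *: (X t *m y)| <= h * delta.
  case: dX => dX dXE.
  have := dX; rewrite /derivable => /cvg_ex[l dl].
  have lE : l = - (X t *m y).
    rewrite -mulmxN -linearN -dXE; apply/esym; exact: (cvg_lim _ dl).
  move/cvgrPdist_le : dl => /(_ _ delta0) dl.
  case: dl => q /= q0 Hq; exists q => //= h hq h0.
  have {Hq} := Hq h hq; rewrite gt_eqF// => /(_ isT).
  rewrite [h *: 1]mulr1 (addrC h) => Hl.
  have -> : X (t + h) - X t + h *: (X t *m y) =
      - (h *: (l - h^-1 *: (X (t + h) - X t))).
    rewrite scalerBr scalerA divff ?gt_eqF// scale1r opprB lE.
    by rewrite scalerN opprK.
  by rewrite normrN normrZ gtr0_norm// ler_wpM2l// ltW.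
have nearphi : \forall h \near 0^'+, `|hat (phi (t + h))| <= 2 * a.
  apply: (near_right_shift (P := fun s => `|hat (phi s)| <= 2 * a)).
  have aC0 : 0 < a / C by rewrite divr_gt0.
  move/cvgrPdist_le : phic => /(_ _ aC0); apply: filterS => s hs.
  have := ler_normB A (hat (v - phi s)); rewrite linearB opprB addrC subrK.
  have : `|hat (v - phi s)| <= a.
    by rewrite (le_trans (hC _))// mulrC -ler_pdivlMr.
  rewrite -/A linearB -/a; lra.
have nearexp : \forall h \near 0^'+, X (t + h) = lie_exp hat (phi (t + h)).
  exact: near_right_shift Xexp.
have Xt : X t = expmx A by rewrite (nbhs_singleton Xexp).
near=> h.
have h0 : 0 < h by near: h; exact: nbhs_right_gt.
have HX : `|X (t + h) - X t + h *: (X t *m y)| <= h * delta by near: h.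
have Hphi : `|hat (phi (t + h))| <= 2 * a by near: h.
have Xh : X (t + h) = expmx (hat (phi (t + h))) by near: h.
set A' := hat (phi (t + h)) in Hphi Xh.
have a2 : a <= 2 * a by lra.
have Ma2 : N%:R * (2 * a) <= 2^-1 by rewrite -/M; lra.
have HD := norm_expmxB_le Ma2 a2 Hphi.
have H1 : `|X t - 1%:M - A| <= a.
  have Ma1 : N%:R * a <= 2^-1 by rewrite -/M; lra.
  have := @norm_expmxB_le _ _ 0 A a Ma1; rewrite normr0 expmx0 subr0 -Xt.
  move=> /(_ (ltW a0) (lexx _)) /le_trans-> //.
  rewrite -/a -/M ler_piMl ?(ltW a0)//; lra.
have HX1 : `|X t - 1%:M| <= 2 * a.
  have := ler_normD (X t - 1%:M - A) A; rewrite subrK -/a; lra.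
pose D := A' - A; pose E := X (t + h) - X t.
rewrite -Xh -Xt -/D -/E -/M in HD HX.
have HXy : `|(X t - 1%:M) *m y| <= 2 * M * a * `|y|.
  rewrite (le_trans (norm_mulmx_le _ _))// -/M ler_wpM2r//.
  by rewrite -mulrA mulrCA ler_wpM2l.
have HXy2 : `|X t *m y| <= 2 * `|y|.
  have -> : X t *m y = (X t - 1%:M) *m y + y by rewrite mulmxBl mul1mx subrK.
  rewrite (le_trans (ler_normD _ _))//.
  have : 2 * M * a * `|y| <= `|y| by rewrite ler_piMl//; lra.
  lra.
have HE : `|E| <= h * (2 * `|y| + delta).
  have := ler_normB (E + h *: (X t *m y)) (h *: (X t *m y)).
  rewrite addrK normrZ gtr0_norm// => /le_trans-> //.
  have := ler_wpM2l (ltW h0) HXy2; lra.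
have HD2 : `|D| <= 2 * `|E|.
  have : 2 * (M * (2 * a)) * `|D| <= 2^-1 * `|D| by rewrite ler_wpM2r//; lra.
  have := ler_normB E (E - D); rewrite opprB addrC subrK; lra.
set w := phi (t + h) - v + h *: (K *m v).
have wE : hat w = - (E - D) + (E + h *: (X t *m y)) - h *: ((X t - 1%:M) *m y).
  rewrite /w linearD linearB linearZ -/A' -/A -/D -/y /=.
  rewrite mulmxBl mul1mx scalerBr; move: (h *: (X t *m y)) (h *: y) => p q.
  by rewrite (opprB E D) (opprB p) (addrA (D - E)) subrK addrACA subrr addr0.
have Hw : `|hat w| <= h * (18 * M * a * `|y| + 2 * delta).
  rewrite wE (le_trans (ler_normB _ _))//.
  have := ler_normD (- (E - D)) (E + h *: (X t *m y)).
  rewrite normrN normrZ gtr0_norm//.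
  have := ler_wpM2l (ltW h0) HXy.
  have h4 : 2 * (M * (2 * a)) * `|D| <= 4 * M * a * (2 * (h * (2 * `|y| + delta))).
    have -> : 2 * (M * (2 * a)) = 4 * M * a by ring.
    rewrite ler_wpM2l ?mulr_ge0 ?(ltW a0)//.
    by rewrite (le_trans HD2)// ler_wpM2l.
  have h5 : 8 * M * a * (h * delta) <= h * delta.
    by rewrite ler_piMl ?(mulr_ge0 (ltW h0) (ltW delta0)).
  nra.
apply: le_trans (hC' w) _.
apply: le_trans (ler_wpM2l (ltW C'0) Hw) _.
rewrite mulrCA ler_wpM2l ?(ltW h0)//.
have dE : C' * (2 * delta) = eta / 2 * `|v| by rewrite /delta; field; rewrite gt_eqF.
rewrite mulrDr dE.
have vr : 36 * (M + 1) * C' * C ^+ 2 * k * `|v| <= eta.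
  by move: vr2; rewrite /r2 ltr_pdivlMr ?mulr_gt0 ?exprn_gt0// mulrC => /ltW.
have ay : M * (a * `|y|) <= (M + 1) * (C * `|v| * (C * k * `|v|)).
  rewrite ler_pM ?mulr_ge0 ?lerDl ?(ltW a0)//.
  by rewrite ler_pM ?(ltW a0).
have := ler_wpM2l (ltW C'0) ay; have := ler_wpM2r (ltW v0) vr; nra.
Unshelve. all: by end_near. Qed.

End LinearizedFlow.

(** * Decay of the Lyapunov form *)

Section LyapunovDecay.
Context {R : realType} {n : nat}.

Lemma dotvv_le (u : 'cV[R]_n) : dotv u u <= (n%:R * `|u|) ^+ 2.
Proof.
apply: (@le_trans _ _ (\sum_(i < n) `|u| ^+ 2)).
  apply: ler_sum => i _; rewrite -expr2 -real_normK ?num_real//.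
  by rewrite lerXn2r ?nnegrE// norm_entry_le.
rewrite sumr_const card_ord -[leLHS]mulr_natl exprMn ler_wpM2r ?sqr_ge0//.
by rewrite -natrX ler_nat; case: (n) => // m; rewrite leq_pmulr.
Qed.

Lemma norm_le_dotvv (u : 'cV[R]_n) : `|u| ^+ 2 <= dotv u u.
Proof.
have s0 : 0 <= dotv u u := dotvv_ge0 _.
rewrite -(sqr_sqrtr s0) lerXn2r ?nnegrE ?sqrtr_ge0//.
apply: norm_mx_le => [|i j]; first exact: sqrtr_ge0.
rewrite ord1 -sqrtr_sqr ler_sqrt// /dotv (bigD1 i)//= expr2 lerDl.
by apply: sumr_ge0 => k _; rewrite -expr2 sqr_ge0.
Qed.

Lemma quadratic_equiv_norm (B : 'M[R]_n) : B \in unitmx ->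
  exists2 beta : R, 0 < beta & forall v,
    dotv (B *m v) (B *m v) <= (beta * `|v|) ^+ 2 /\
    `|v| ^+ 2 <= beta ^+ 2 * dotv (B *m v) (B *m v).
Proof.
move=> Bu; pose b1 := n%:R * (n%:R * `|B|); pose b2 := n%:R * `|invmx B|.
have b10 : 0 <= b1 by rewrite !mulr_ge0.
have b20 : 0 <= b2 by rewrite !mulr_ge0.
exists (1 + b1 + b2) => [|v]; first lra.
have b0 : 0 <= 1 + b1 + b2 by lra.
split.
  rewrite (le_trans (dotvv_le _))// lerXn2r ?nnegrE ?mulr_ge0//.
  apply: (@le_trans _ _ (b1 * `|v|)).
    by rewrite -mulrA ler_wpM2l// norm_mulmx_le.
  by rewrite ler_wpM2r//; lra.
apply: (@le_trans _ _ ((1 + b1 + b2) ^+ 2 * `|B *m v| ^+ 2)); last first.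
  by rewrite ler_wpM2l ?sqr_ge0// norm_le_dotvv.
rewrite -exprMn lerXn2r ?nnegrE ?mulr_ge0//.
rewrite -{1}(mulKmx Bu v) (le_trans (norm_mulmx_le _ _))// -/b2 ler_wpM2r//; lra.
Qed.

(** The decrease of the Lyapunov form survives the nonlinear error. Over a time
    h the linear part lowers |B v|^2 by at least 2 h c |B v|^2 + O(h^2), and an
    error w with |w| <= h c / (4 beta^2) |v| costs at most half of h c |B v|^2;
    the remaining half of h c |B v|^2 absorbs the O(h^2) terms when h < h0. *)
Lemma lyapunov_step (B K : 'M[R]_n) c beta : 0 < c -> 0 < beta ->
  (forall v, c * dotv (B *m v) (B *m v) <= dotv (B *m v) (B *m (K *m v))) ->
  (forall v, dotv (B *m v) (B *m v) <= (beta * `|v|) ^+ 2 /\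
    `|v| ^+ 2 <= beta ^+ 2 * dotv (B *m v) (B *m v)) ->
  exists2 h0 : R, 0 < h0 & forall h v v', 0 < h -> h < h0 ->
    `|v' - v + h *: (K *m v)| <= h * (c / (4 * beta ^+ 2) * `|v|) ->
    dotv (B *m v') (B *m v') <= (1 - h * c) * dotv (B *m v) (B *m v).
Proof.
move=> c0 b0 hB hb.
pose mu := (beta ^+ 2 * (n%:R * `|K|)) ^+ 2.
have mu0 : 0 <= mu by exact: sqr_ge0.
have m2 : 0 < 2 * mu + c ^+ 2 by have := exprn_gt0 2 c0; lra.
exists ((c / 2) / (2 * mu + c ^+ 2)) => [|h v v' h0].
  by rewrite divr_gt0 ?divr_gt0.
rewrite ltr_pdivlMr// => hsmall.
set w := (X in `|X|) => hw.
have v'E : v' = v - h *: (K *m v) + w.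
  by rewrite addrC /w addrA (addrAC _ _ v) subrK addrK.
set W := dotv (B *m v) (B *m v).
have W0 : 0 <= W := dotvv_ge0 _.
have [hv1 hv2] := hb v.
have hBw : dotv (B *m w) (B *m w) <= h ^+ 2 * (c ^+ 2 / 16) * W.
  have [hw1 _] := hb w; apply: le_trans hw1 _.
  have p0 : 0 <= c / (4 * beta ^+ 2).
    by rewrite divr_ge0 ?mulr_ge0 ?sqr_ge0// ltW.
  apply: (@le_trans _ _ ((beta * (h * (c / (4 * beta ^+ 2) * `|v|))) ^+ 2)).
    move: (c / (4 * beta ^+ 2)) p0 hw => e p0 hw.
    by rewrite lerXn2r ?nnegrE ?mulr_ge0 ?(ltW b0) ?(ltW h0)// ler_wpM2l// ltW.
  apply: (@le_trans _ _ ((beta * h * (c / (4 * beta ^+ 2))) ^+ 2 * (beta ^+ 2 * W))).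
    rewrite [leLHS](_ : _ = (beta * h * (c / (4 * beta ^+ 2))) ^+ 2 * `|v| ^+ 2).
      by rewrite ler_wpM2l ?sqr_ge0.
    by ring.
  rewrite le_eqVlt; apply/orP; left; apply/eqP; field; exact: lt0r_neq0.
have hBK : dotv (B *m (K *m v)) (B *m (K *m v)) <= mu * W.
  have [hK1 _] := hb (K *m v); apply: le_trans hK1 _.
  apply: (@le_trans _ _ ((beta * (n%:R * `|K| * `|v|)) ^+ 2)).
    rewrite lerXn2r ?nnegrE ?mulr_ge0 ?(ltW b0)//.
    by rewrite ler_wpM2l ?(ltW b0)// norm_mulmx_le.
  apply: (@le_trans _ _ ((beta * (n%:R * `|K|)) ^+ 2 * (beta ^+ 2 * W))).
    by rewrite [beta * (_ * `|v|)]mulrA exprMn ler_wpM2l ?sqr_ge0.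
  by rewrite le_eqVlt; apply/orP; left; apply/eqP; rewrite /mu; ring.
have hL := hB v; rewrite -/W in hL.
rewrite v'E mulmxDr mulmxBr -scalemxAr.
move: hL hBw hBK.
set p := B *m v; set q := B *m (K *m v); set s := B *m w => hL hBw hBK.
have hc0 : 0 < h * (c / 4) by rewrite mulr_gt0 ?divr_gt0.
have y1 := @dotv_young _ _ _ p s hc0.
have y2 := @dotv_young _ _ 1 (- h *: q) s ltr01.
have y3 : (h * (c / 4))^-1 * dotv s s <= h * (c / 4) * W.
  rewrite ler_pdivrMl//; apply: le_trans hBw _.
  by rewrite le_eqVlt; apply/orP; left; apply/eqP; field.
have expand : dotv (p - h *: q + s) (p - h *: q + s) = W - 2 * h * dotv p q
   + 2 * dotv p s + h ^+ 2 * dotv q q + 2 * dotv (- h *: q) s + dotv s s.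
  rewrite -scaleNr (dotvC (- h *: q) s) !dotvDr !dotvZr.
  rewrite !(dotvC (p + _ + s)) !dotvDr !dotvZr -/W (dotvC q p) (dotvC s p) (dotvC s q).
  ring.
have qq : dotv (- h *: q) (- h *: q) = h ^+ 2 * dotv q q.
  by rewrite dotvZr dotvC dotvZr; ring.
rewrite qq invr1 !mul1r -/W in y1 y2.
rewrite expand.
have t1 := ler_wpM2l (ltW h0) hL.
have t2 := ler_wpM2l (sqr_ge0 h) hBK.
have t3 : h * (h * (2 * mu + c ^+ 2)) * W <= h * (c / 2) * W.
  by rewrite ler_wpM2r// ler_wpM2l// ltW.
have t4 : 0 <= h ^+ 2 * c ^+ 2 * W by exact: (mulr_ge0 (mulr_ge0 (sqr_ge0 h) (sqr_ge0 c)) W0).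
nra.
Qed.

End LyapunovDecay.

(** * Exponential stability *)

Section Assembly.
Context {R : realType}.

Lemma near_lifespan (T : \bar R) (t : R) : 0 < t -> (t%:E < T)%E ->
  \forall s \near t, 0 <= s /\ (s%:E < T)%E.
Proof.
move=> t0 tT.
have n0 : \forall s \near t, 0 < s by exact: lt_nbhsr.
have nT : \forall s \near t, (s%:E < T)%E.
  case: T tT => [T| |] //=; last by move=> _; near=> s; exact: ltry.
  rewrite lte_fin => tT; near=> s; rewrite lte_fin; near: s; exact: lt_nbhsl.
by near=> s; split; [apply: ltW|]; near: s.
Unshelve. all: by end_near. Qed.

Lemma continuous_quadratic n (B : 'M[R]_n) :
  continuous (fun v : 'cV[R]_n => dotv (B *m v) (B *m v)).
Proof.
have Bc i : continuous (fun v : 'cV[R]_n => (B *m v) i 0).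
  move=> v.
  rewrite (_ : (fun v : 'cV[R]_n => _) = fun v => \sum_k B i k * v k 0); last first.
    by apply/funext => u; rewrite mxE.
  apply: (@cvg_big _ _ _ _ _ add_continuous _ (nbhs v)) => k _.
  by apply: cvgM; [exact: cvg_cst|exact: coord_continuous].
move=> v; apply: (@cvg_big _ _ _ _ _ add_continuous _ (nbhs v)) => i _.
by apply: cvgM; exact: Bc.
Qed.

Lemma enormE n (v : 'cV[R]_n) : enorm v = Num.sqrt (dotv v v).
Proof. by rewrite /enorm; congr Num.sqrt; apply: eq_bigr => i _; rewrite expr2. Qed.

Lemma equilibrium_trajectory N n (G : set 'M[R]_N)
    (hat : {linear 'cV[R]_n -> 'M[R]_N}) (K : 'M[R]_n) :
  G 1%:M -> closed_loop G hat K +oo%E (cst 1%:M) (cst 0).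
Proof.
move=> G1; split => //.
- by move=> t _ _; rewrite /lie_exp linear0 expmx0.
- by move=> x; exact: cvg_cst.
- by move=> t _ _; rewrite mulmx0 oppr0 linear0 mulmx0; exact: is_derive_cst.
Qed.

End Assembly.

Theorem theorem3 (R : realType) (N n : nat) (G : set 'M[R]_N)
    (hat : {linear 'cV[R]_n -> 'M[R]_N}) (K : 'M[R]_n)
    (hG : matrix_lie_group G) (hhat : hat_isomorphism G hat)
    (hK : only_positive_eigenvalues K) :
  exponentially_stable_at0
    (fun (T : \bar R) (phi : R -> 'cV[R]_n) =>
       exists X : R -> 'M[R]_N, closed_loop G hat K T X phi).
Proof.
split; first by exists (cst 1%:M); exact: equilibrium_trajectory (mlg_one hG).
have [hat_inj _] := hhat.
have [B [c c0 [Bu hB]]] := lyapunov_form hK.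
have [b b0 hb] := quadratic_equiv_norm Bu.
have [h0 h00 step] := lyapunov_step c0 b0 hB hb.
have e0 : 0 < c / (4 * b ^+ 2) by rewrite divr_gt0 ?mulr_gt0 ?exprn_gt0.
have [r r0 lin] := linearized_flow K hat_inj e0.
pose W (v : 'cV[R]_n) := dotv (B *m v) (B *m v).
have W0 v : 0 <= W v := dotvv_ge0 _.
pose rW := (r / b) ^+ 2; have rb0 : 0 < r / b by rewrite divr_gt0.
have rW0 : 0 < rW by rewrite exprn_gt0.
exists (c / 2), ((n%:R + 1) * b ^+ 2), [set v | W v < rW].
have beta0 : 0 < (n%:R + 1) * b ^+ 2 :> R by rewrite mulr_gt0 ?ltr_wpDl ?exprn_gt0.
split=> [||| T phi [X [_ Xexp phic Xode]] /= Wr t t0 tT] //.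
- by rewrite divr_gt0.
- have : W v @[v --> (0 : 'cV[R]_n)] --> W 0 by exact: continuous_quadratic.
  have -> : W 0 = 0 by rewrite /W mulmx0 /dotv big1// => i _; rewrite mxE mulr0.
  move/cvgr_lt; apply; exact: rW0.
have decay : W (phi t) <= W (phi 0) * expR (- c * t).
  apply: (exponential_comparison (W := W \o phi) (T := T) (r := rW)) => //.
  - exact: W0.
  - apply/subspace_continuousP => x xD.
    apply: (cvg_comp phi W); last exact: continuous_quadratic.
    by move/subspace_continuousP : phic; apply.
  move=> {t0 tT} s s0 sT /= Ws0 Wsr.
  have near_s := near_lifespan s0 sT.
  have phis : phi @ s --> phi s.
    move/subspace_continuousP : phic => /(_ s (conj (ltW s0) sT)).
    by rewrite within_interior.
  have [ps0 psr] : 0 < `|phi s| /\ `|phi s| < r.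
    have [hs1 hs2] := hb (phi s); split.
      rewrite normr_gt0; apply: contraTneq Ws0 => ->.
      by rewrite /W mulmx0 -leNgt /dotv big1// => i _; rewrite mxE mulr0.
    have : `|phi s| ^+ 2 < r ^+ 2.
      apply: le_lt_trans hs2 _; rewrite -[r](divfK (lt0r_neq0 b0)) mulrC exprMn.
      by rewrite ltr_pM2r ?exprn_gt0.
    by rewrite ltr_pXn2r ?nnegrE// ltW.
  have sX : \forall u \near s, X u = lie_exp hat (phi u).
    by apply: filterS near_s => u [u0 uT]; exact: Xexp.
  have nl := lin X phi s sX phis (Xode s s0 sT) ps0 psr.
  near=> h; apply: step; last by near: h.
  - by near: h; exact: nbhs_right_gt.
  - by near: h; exact: nbhs_right_lt.
rewrite !enormE.
have bW : dotv (phi t) (phi t) <=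
    ((n%:R + 1) * b ^+ 2) ^+ 2 * dotv (phi 0) (phi 0) * expR (- c * t).
  apply: le_trans (dotvv_le _) _.
  have [_ h2] := hb (phi t); have [h1 _] := hb (phi 0).
  rewrite exprMn.
  apply: (@le_trans _ _ ((n%:R + 1) ^+ 2 *
    (b ^+ 2 * (b ^+ 2 * dotv (phi 0) (phi 0) * expR (- c * t))))).
    rewrite ler_pM ?sqr_ge0//; first by rewrite lerXn2r ?nnegrE ?addr_ge0 ?lerDl.
    apply: le_trans h2 _; rewrite ler_wpM2l ?sqr_ge0//.
    apply: le_trans decay _; rewrite ler_wpM2r ?expR_ge0//.
    by apply: le_trans h1 _; rewrite exprMn ler_wpM2l ?sqr_ge0 ?norm_le_dotvv.
  by rewrite le_eqVlt; apply/orP; left; apply/eqP; ring.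
have -> : expR (- (c / 2) * t) = Num.sqrt (expR (- c * t)).
  rewrite (_ : - c * t = 2%:R * (- (c / 2) * t)); last by field.
  by rewrite expRM_natl sqrtr_sqr ger0_norm// expR_ge0.
rewrite -[X in X * _ * _](ger0_norm (ltW beta0)) -sqrtr_sqr.
have s0 : 0 <= ((n%:R + 1) * b ^+ 2) ^+ 2 :> R := sqr_ge0 _.
by rewrite -sqrtrM// -sqrtrM ?(mulr_ge0 s0 (dotvv_ge0 _))// ler_wsqrtr.
Unshelve. all: by end_near. Qed.
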